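(* For each $i=0,1,\ldots,d-1$ let $\mathcal{F}_{(n,(i,d-i))}\subseteq\{0,1\}^n$ be an almost optimal $(n,(i,d-i))$-cover-free family constructed in linear time, and let $$\mathcal{U}_{(n,d)}=\bigcup_{i=0}^{d-1}\mathcal{F}_{(n,(i,d-i))}.$$ Then $\mathcal{U}_{(n,d)}$ is an explicitly (i.e. in polynomial time) constructed $(n,d)$-universal set over the alphabet $\Sigma=\{0,1\}$, of size $d\cdot 2^{d+o(d)}\cdot\log n$.
   Context: An $(n,d)$-universal set over an alphabet $\Sigma$ is a set $\mathcal{U}\subseteq\Sigma^{n}$ such that for every $1\le i_1<i_2<\cdots<i_d\le n$ and every $(\sigma_1,\ldots,\sigma_d)\in\Sigma^{d}$ there is $a\in\mathcal{U}$ such that $a_{i_j}=\sigma_j$ for all $j=1,\ldots,d$. Let $r,s<n$ and $d=r+s$. Let $X$ be a set with $N$ elements and $\mathcal{B}$ a set of $n$ subsets (blocks) of $X$. The pair $(X,\mathcal{B})$ is an $(n,(r,s))$-cover-free family (CFF) if for any $r$ blocks $B_1,\ldots,B_r\in\mathcal{B}$ and any other $s$ blocks $A_1,\ldots,A_s\in\mathcal{B}$ (distinct from the $B$'s), $\bigcap_{i=1}^{r}B_i\not\subseteq\bigcup_{j=1}^{s}A_j$, i.e. some element of $X$ lies in all the $B$'s and in none of the $A$'s. Equivalently, the CFF is viewed as the family $\mathcal{F}\subseteq\{0,1\}^n$, $|\mathcal{F}|=N$, of rows of the $N\times n$ boolean incidence matrix whose columns are the characteristic vectors of the blocks; $\mathcal{F}_{(n,(r,s))}$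 denotes such a family. When $r=0$ the condition says that for any $s$ blocks some element of $X$ lies in none of them. Put $N(r,s):=\dfrac{d\binom{d}{r}}{\log\binom{d}{r}}$. An $(n,(r,s))$-CFF $\mathcal{F}$ is almost optimal if its size $N=|\mathcal{F}|$ satisfies $N=N(r,s)^{1+o(1)}\cdot\log n$, and, for $r=O(d)$, $N=N(r,s)^{1+o(1)}\cdot\log n=2^{H_2(r/d)d+o(d)}\cdot\log n$, where $H_2$ is the binary entropy function and the $o(1)$ term is independent of $n$ and tends to $0$ as $d\to\infty$. It is constructed in linear time if it is constructed in time $O(N(r,s)^{1+o(1)}\cdot\log n\cdot n)$. Almost optimal CFFs constructed in linear time are taken from the known constructions of Bshouty, of Bshouty et al., and of Fomin et al. Polynomial time, for an alphabet of size $q$, means time $\mathrm{poly}(q^d,n)$; here $q=2$.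
   Formalization: The union is taken over i=0,…,d instead of i=0,…,d−1, adding an almost optimal, linear-time (n,(d,0))-family; as printed the claim fails, e.g. for d=1, since no row need have ones on d given coordinates. *)

(* Defs.v *)
(* MathComp / MathComp-Analysis *)
From HB Require Import structures.
From mathcomp Require Import all_boot all_order all_algebra.
From mathcomp Require Import all_classical all_reals all_analysis.

Set Implicit Arguments.
Unset Strict Implicit.
Unset Printing Implicit Defensive.

Import Order.TTheory GRing.Theory Num.Theory.
Import numFieldNormedType.Exports.

Local Open Scope ring_scope.

Definition universal_set (Sigma : finType) (n d : nat)
    (U : {set n.-tuple Sigma}) : Prop :=
  forall (i : 'I_d -> 'I_n) (sigma : 'I_d -> Sigma),
    (forall j k : 'I_d, (j < k)%N -> (i j < i k)%N) ->
    exists2 a, a \in U & forall j : 'I_d, tnth a (i j) = sigma j.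

(* A family is given by the rows of its incidence matrix: the coordinates
   'I_n index the blocks, and an element of F is an element of the ground set
   (tnth a k holds when that element lies in block k). *)
Definition cover_free (n r s : nat) (F : {set n.-tuple bool}) : Prop :=
  forall B A : {set 'I_n}, #|B| = r -> #|A| = s -> [disjoint B & A] ->
    exists2 a, a \in F &
      (forall k, k \in B -> tnth a k) /\ (forall k, k \in A -> ~~ tnth a k).

Definition log2 (R : realType) (x : R) : R := ln x / ln 2.

(* ln 0 = 0, so H2 0 = H2 1 = 0. *)
Definition H2 (R : realType) (p : R) : R :=
  - (p * log2 p) - (1 - p) * log2 (1 - p).

(* For r = 0 or s = 0 the denominator is log 1 = 0; the value is then
   meaningless and is not used below. *)
Definition cff_bound (R : realType) (r s : nat) : R :=
  let d := (r + s)%N in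
  (d * 'C(d, r))%:R / log2 ('C(d, r))%:R.

Definition vanishing (R : realType) (e : nat -> R) : Prop :=
  (e @ \oo --> (0 : R))%classic.

(* A family of families, one for each (n, (r, s)) with 0 < r + s < n.
   Equations "size = A^(1 + o(1)) log n" and "size = 2^(H d + o(d)) log n" are
   two-sided; the error is bounded by a function e of d = r + s alone. *)
Definition almost_optimal (R : realType)
    (F : forall n r s : nat, {set n.-tuple bool}) : Prop :=
  exists2 e : nat -> R, vanishing e &
  forall n r s : nat, (0 < r + s < n)%N ->
    let d := (r + s)%N in
    ((0 < r)%N -> (0 < s)%N ->
      exists2 x : R, `|x| <= e d &
        #|F n r s|%:R = cff_bound R r s `^ (1 + x) * log2 n%:R) /\
    (exists2 y : R, `|y| <= e d * d%:R &
        #|F n r s|%:R = 2 `^ (H2 (r%:R / d%:R) * d%:R + y) * log2 n%:R).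

(* Unit-cost random access machine of Cook and Reckhow (constants, addition,
   truncated subtraction, indirect load and store, print), with structured
   control instead of jumps. Registers are directly addressed and finitely many
   occur in a program; memory is indirectly addressed. There is deliberately no
   unit-cost multiplication: with it, unit-cost polynomial time would not be
   Turing-machine polynomial time. *)
Inductive cmd : Type :=
| Skip
| Const (x c : nat)
| Add (x y z : nat)
| Sub (x y z : nat)
| Read (x y : nat)
| Write (x y : nat)
| Output (x : nat)
| Seq (c1 c2 : cmd)
| If (x : nat) (c1 c2 : cmd)
| While (x : nat) (c : cmd).

Record state : Type := State { reg : nat -> nat; mem : nat -> nat }.

Definition upd (f : nat -> nat) (a v : nat) : nat -> nat :=
  fun b => if b == a then v else f b.

Definition set_reg (m : state) (x v : nat) : state :=
  State (upd (reg m) x v) (mem m).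

Definition set_mem (m : state) (a v : nat) : state :=
  State (reg m) (upd (mem m) a v).

(* run c m t w m': from m, the program c halts in m' after exactly t steps,
   having printed w. *)
Inductive run : cmd -> state -> nat -> seq nat -> state -> Prop :=
| run_skip m : run Skip m 1 [::] m
| run_const m x c : run (Const x c) m 1 [::] (set_reg m x c)
| run_add m x y z :
    run (Add x y z) m 1 [::] (set_reg m x (reg m y + reg m z)%N)
| run_sub m x y z :
    run (Sub x y z) m 1 [::] (set_reg m x (reg m y - reg m z)%N)
| run_read m x y :
    run (Read x y) m 1 [::] (set_reg m x (mem m (reg m y)))
| run_write m x y :
    run (Write x y) m 1 [::] (set_mem m (reg m x) (reg m y))
| run_output m x : run (Output x) m 1 [:: reg m x] m
| run_seq c1 c2 m1 m2 m3 t1 t2 w1 w2 :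
    run c1 m1 t1 w1 m2 -> run c2 m2 t2 w2 m3 ->
    run (Seq c1 c2) m1 (t1 + t2)%N (w1 ++ w2) m3
| run_if_true x c1 c2 m m' t w :
    reg m x <> 0%N -> run c1 m t w m' -> run (If x c1 c2) m t.+1 w m'
| run_if_false x c1 c2 m m' t w :
    reg m x = 0%N -> run c2 m t w m' -> run (If x c1 c2) m t.+1 w m'
| run_while_done x c m : reg m x = 0%N -> run (While x c) m 1 [::] m
| run_while_step x c m1 m2 m3 t1 t2 w1 w2 :
    reg m1 x <> 0%N -> run c m1 t1 w1 m2 -> run (While x c) m2 t2 w2 m3 ->
    run (While x c) m1 (t1 + t2).+1 (w1 ++ w2) m3.

Definition init (args : seq nat) : state :=
  State (fun x => nth 0%N args x) (fun=> 0%N).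

(* The output is the concatenation of the words of a list whose set of elements
   is F; the list may contain repetitions. *)
Definition constructs (P : cmd) (args : seq nat) (n : nat)
    (F : {set n.-tuple bool}) (t : nat) : Prop :=
  exists (rows : seq (n.-tuple bool)) (m : state),
    rows =i F /\
    run P (init args) t (flatten [seq map nat_of_bool (val a) | a <- rows]) m.

(* Time O(A^(1 + o(1)) log n * n), A = cff_bound r s, for a single program with
   input (n, r, s). For r = 0 or s = 0, where A is undefined, A^(1 + o(1)) is
   replaced by 2^(H2(r/d) d + o(d)) = 2^(o(d)). *)
Definition linear_time (R : realType)
    (F : forall n r s : nat, {set n.-tuple bool}) : Prop :=
  exists (P : cmd) (C : R) (e : nat -> R), vanishing e /\
  forall n r s : nat, (0 < r + s < n)%N ->
    let d := (r + s)%N in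
    let scale := if (0 < r)%N && (0 < s)%N then cff_bound R r s `^ (1 + e d)
                 else 2 `^ (e d * d%:R) in
    exists2 t : nat, constructs P [:: n; r; s] (F n r s) t &
      t%:R <= C * (scale * log2 n%:R * n%:R).

(* Time poly(q^d, n), q = 2, for a single program with input (n, d). *)
Definition poly_time (U : forall n d : nat, {set n.-tuple bool}) : Prop :=
  exists (P : cmd) (c k : nat),
  forall n d : nat, (0 < d < n)%N ->
    exists2 t : nat, constructs P [:: n; d] (U n d) t &
      (t <= c * (2 ^ d + n) ^ k)%N.

(* The last index i = d cannot be omitted: the families with i < d need not
   contain a vector equal to 1 on d given coordinates. *)
Definition cff_union (F : forall n r s : nat, {set n.-tuple bool})
    (n d : nat) : {set n.-tuple bool} :=
  (\bigcup_(i < d.+1) F n i (d - i)%N)%SET.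

(* Main.v *)
Require Import Defs.
From mathcomp Require Import all_boot all_order all_algebra.
From mathcomp Require Import all_classical all_reals all_analysis.
From mathcomp Require Import zify ring lra.
Import Order.TTheory GRing.Theory Num.Theory.
Import numFieldNormedType.Exports.
Local Open Scope ring_scope.

(** Universality: let a pattern of zeros and ones be prescribed on d
    coordinates, and let i be its number of ones. The (i, d - i)-cover-free
    family has a row equal to 1 on the i coordinates marked one and to 0 on the
    d - i others, and this family is one of those united
    ([cff_union_universal]).

    Construction: a program P that prints any single family, given its
    parameters, is run for i = 0, ..., d in turn. The point is that P expects
    clean registers and a clean memory, while each run leaves its garbage
    behind, at addresses that nobody records. So P is not run literally but
    interpreted, instruction by instruction, by [guest]: its registers are
    shifted out of the way of the driving loop, and its memory cell a is
    represented by two cells, 2a for the value and 2a + 1 for the epoch (the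
    number of the run) of the last write. A value with an outdated stamp is read
    as 0, so advancing the epoch erases the whole memory in one step. The
    interpretation costs a constant factor ([guest_run]), and the loop prints
    the d + 1 families one after the other ([union_prog_constructs]). The time
    is polynomial because an error function that tends to 0 is bounded, so each
    family takes time polynomial in 2^d and n ([linear_time_poly]).

    Size: binary entropy is at most 1, so every family has at most
    2^(d + o(d)) log n rows, and the union at most (d + 1) times as many. For
    the lower bound the single family i = floor(d / 2) is enough, since the
    entropy at i / d is then 1 - O(1 / d). Both bounds agree with
    d 2^d log n up to a factor 2^(o(d)), since d = 2^(log d) and
    log d = o(d) ([cff_union_size]). *)

Set Implicit Arguments.
Unset Strict Implicit.

(** * Interpreting a program in a memory that can be erased in one step *)

Local Open Scope nat_scope.

Local Notation rN := 0%N (only parsing).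
Local Notation rLeft := 1%N (only parsing).
Local Notation rEpoch := 2%N (only parsing).
Local Notation rOne := 3%N (only parsing).
Local Notation rZero := 4%N (only parsing).
Local Notation rAddr := 5%N (only parsing).
Local Notation rTmp := 6%N (only parsing).

(** Registers 0 to 6 belong to the driving loop; 0 and 1 are those where its
    input (n, d) is found. *)
Definition guest_reg (x : nat) : nat := x.+4.+3.

(** Since no stamp exceeds the current epoch, a stamp is outdated exactly when
    the truncated difference of the epoch and the stamp is nonzero; this is the
    test made when a cell is read. *)
Fixpoint guest (c : cmd) : cmd :=
  match c with
  | Skip => Skip
  | Const x k => Const (guest_reg x) k
  | Add x y z => Add (guest_reg x) (guest_reg y) (guest_reg z)
  | Defs.Sub x y z => Defs.Sub (guest_reg x) (guest_reg y) (guest_reg z)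
  | Read x y =>
      Seq (Add rAddr (guest_reg y) (guest_reg y)) (Seq (Add rTmp rAddr rOne)
      (Seq (Read rTmp rTmp) (Seq (Defs.Sub rTmp rEpoch rTmp)
      (If rTmp (Const (guest_reg x) 0) (Read (guest_reg x) rAddr)))))
  | Write x y =>
      Seq (Add rAddr (guest_reg x) (guest_reg x))
      (Seq (Write rAddr (guest_reg y))
      (Seq (Add rAddr rAddr rOne) (Write rAddr rEpoch)))
  | Output x => Output (guest_reg x)
  | Seq c1 c2 => Seq (guest c1) (guest c2)
  | If x c1 c2 => If (guest_reg x) (guest c1) (guest c2)
  | While x c1 => While (guest_reg x) (guest c1)
  end.

Fixpoint reg_bound (c : cmd) : nat :=
  match c with
  | Skip => 0
  | Const x _ | Output x => x.+1
  | Add x y z | Defs.Sub x y z => maxn x.+1 (maxn y.+1 z.+1)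
  | Read x y | Write x y => maxn x.+1 y.+1
  | Seq c1 c2 => maxn (reg_bound c1) (reg_bound c2)
  | If x c1 c2 => maxn x.+1 (maxn (reg_bound c1) (reg_bound c2))
  | While x c1 => maxn x.+1 (reg_bound c1)
  end.

Definition host (n l ep : nat) (M : state) : Prop :=
  [/\ reg M rN = n, reg M rLeft = l, reg M rEpoch = ep, reg M rOne = 1%N
    & reg M rZero = 0%N].

Definition stamp (M : state) (a : nat) : nat := Defs.mem M (a + a).+1.

(** The guest state m as represented in the machine state M. Only the registers
    below b are represented: a program mentions finitely many, so these are the
    ones that can be cleared between two runs. *)
Record simulates (b n l ep : nat) (m M : state) : Prop := Simulates {
  sim_host : host n l ep M;
  sim_reg : forall x, (x < b)%N -> reg M (guest_reg x) = reg m x;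
  sim_mem : forall a,
    Defs.mem m a = if stamp M a == ep then Defs.mem M (a + a)%N else 0%N;
  sim_stamp : forall a, (stamp M a <= ep)%N }.

Lemma sim_set_reg b n l ep m M x v : simulates b n l ep m M ->
  simulates b n l ep (set_reg m x v) (set_reg M (guest_reg x) v).
Proof.
case=> H R Me S; split => // y yb /=; rewrite /upd /= /guest_reg !eqSS.
by case: eqP => // _; apply: R.
Qed.

Lemma sim_set_scratch b n l ep m M x v : (rAddr <= x <= rTmp)%N ->
  simulates b n l ep m M -> simulates b n l ep m (set_reg M x v).
Proof.
move=> xr [[H1 H2 H3 H4 H5] R Me S]; split => //.
- by split; rewrite /= /upd ifF //; apply/eqP; lia.
- move=> y yb; rewrite /= /upd ifF; first exact: R.
  by apply/eqP; rewrite /guest_reg; lia.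
Qed.

Lemma sim_set_mem b n l ep m M a v : simulates b n l ep m M ->
  simulates b n l ep (Defs.set_mem m a v)
    (Defs.set_mem (Defs.set_mem M (a + a)%N v) (a + a).+1 ep).
Proof.
case=> H R Me S; split => //.
- move=> c; rewrite /stamp /= /upd eqSS.
  have -> : ((c + c).+1 == a + a)%N = false by apply/eqP; lia.
  have -> : (c + c == (a + a).+1)%N = false by apply/eqP; lia.
  have -> : (c + c == a + a)%N = (c == a) by apply/eqP/eqP; lia.
  by case: eqP => _; [rewrite eqxx | rewrite Me].
- move=> c; rewrite /stamp /= /upd eqSS.
  have -> : ((c + c).+1 == a + a)%N = false by apply/eqP; lia.
  by case: eqP => // _; apply: S.
Qed.

(** The factor 6 is the cost of a guest read, the most expensive instruction;
    control structures cost the guest and its interpretation the same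
    overhead. *)
Lemma guest_run b n l ep c m t w m' : run c m t w m' -> (reg_bound c <= b)%N ->
  forall M, simulates b n l ep m M ->
  exists t' M', [/\ run (guest c) M t' w M', simulates b n l ep m' M'
    & (t' <= 6 * t)%N].
Proof.
move=> H; elim: H => {c m t w m'} /=.
- by move=> m _ M S; exists 1%N, M; split => //; apply: run_skip.
- move=> m x k _ M S; exists 1%N, (set_reg M (guest_reg x) k).
  by split => //; [apply: run_const | apply: sim_set_reg].
- move=> m x y z; rewrite !geq_max => /and3P[_ yb zb] M S.
  exists 1%N, (set_reg M (guest_reg x) (reg m y + reg m z)); split => //.
    by rewrite -!(sim_reg S) //; apply: run_add.
  exact: sim_set_reg.
- move=> m x y z; rewrite !geq_max => /and3P[_ yb zb] M S.
  exists 1%N, (set_reg M (guest_reg x) (reg m y - reg m z)); split => //.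
    by rewrite -!(sim_reg S) //; apply: run_sub.
  exact: sim_set_reg.
- move=> m x y; rewrite !geq_max => /andP[_ yb] M S.
  pose a := reg m y.
  pose M3 := set_reg (set_reg (set_reg M rAddr (a + a)) rTmp (a + a).+1)
    rTmp (stamp M a).
  pose M4 := set_reg M3 rTmp (ep - stamp M a).
  have S4 : simulates b n l ep m M4 by do 4![apply: sim_set_scratch => //].
  (* Both branches of the final test load the same value, mem m a, because
     cells with an outdated stamp hold 0 for the guest. *)
  exists 6%N, (set_reg M4 (guest_reg x) (Defs.mem m a)).
  split => //; last exact: sim_set_reg.
  have [H1 H2 H3 H4 H5] := sim_host S.
  have Ra : reg M (guest_reg y) = a by apply: (sim_reg S).
  rewrite -[6%N]/(1 + (1 + (1 + (1 + 2))))%N.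
  apply: (@run_seq _ _ _ _ _ _ _ [::] [::]).
    by have := run_add M rAddr (guest_reg y) (guest_reg y); rewrite Ra; apply.
  apply: (@run_seq _ _ _ _ _ _ _ [::] [::]).
    have := run_add (set_reg M rAddr (a + a)) rTmp rAddr rOne.
    by rewrite /= /upd /= H4 addn1; apply.
  apply: (@run_seq _ _ _ _ _ _ _ [::] [::]).
    by apply: run_read.
  apply: (@run_seq _ _ _ M4 _ _ _ [::] [::]).
    have := run_sub M3 rTmp rEpoch rTmp.
    by rewrite /M4 /= /upd /= H3; apply.
  have Se := sim_mem S a; have Ss := sim_stamp S a.
  case: (eqVneq (stamp M a) ep) Se => [E | E] Ea.
    apply: run_if_false; first by rewrite /= /upd /=; lia.
    have := run_read M4 (guest_reg x) rAddr.
    by rewrite /= /upd /= -/a Ea; apply.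
  apply: run_if_true; first by move/eqP: E; rewrite /= /upd /=; lia.
  by rewrite Ea; apply: run_const.
- move=> m x y; rewrite !geq_max => /andP[xb yb] M S.
  pose a := reg m x; pose v := reg m y.
  pose M1 := set_reg (set_reg M rAddr (a + a)) rAddr (a + a).+1.
  have S1 : simulates b n l ep m M1 by do 2![apply: sim_set_scratch => //].
  exists 4%N, (Defs.set_mem (Defs.set_mem M1 (a + a) v) (a + a).+1 ep).
  split => //; last exact: sim_set_mem.
  have [H1 H2 H3 H4 H5] := sim_host S.
  have Ra : reg M (guest_reg x) = a by apply: (sim_reg S).
  have Rv : reg M (guest_reg y) = v by apply: (sim_reg S).
  rewrite -[4%N]/(1 + (1 + (1 + 1)))%N.
  apply: (@run_seq _ _ _ _ _ _ _ [::] [::]).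
    by have := run_add M rAddr (guest_reg x) (guest_reg x); rewrite Ra; apply.
  pose M2 := Defs.set_mem (set_reg M rAddr (a + a)) (a + a) v.
  apply: (@run_seq _ _ _ M2 _ _ _ [::] [::]).
    by rewrite /M2 -Rv; apply: (run_write (set_reg M rAddr (a + a)) rAddr).
  apply: (@run_seq _ _ _ (set_reg M2 rAddr (a + a).+1) _ _ _ [::] [::]).
    by have := run_add M2 rAddr rAddr rOne; rewrite /= /upd /= H4 addn1; apply.
  have := run_write (set_reg M2 rAddr (a + a).+1) rAddr rEpoch.
  by rewrite /= /upd /= H3; apply.
- move=> m x xb M S; exists 1%N, M; split => //.
  by rewrite -(sim_reg S) //; apply: run_output.
- move=> c1 c2 m1 m2 m3 t1 t2 w1 w2 _ IH1 _ IH2.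
  rewrite geq_max => /andP[b1 b2] M S.
  have [t1' [M1 [r1 S1 h1]]] := IH1 b1 M S.
  have [t2' [M2 [r2 S2 h2]]] := IH2 b2 M1 S1.
  exists (t1' + t2')%N, M2; split => //; [exact: run_seq r1 r2 | lia].
- move=> x c1 c2 m m' t w nz _ IH; rewrite !geq_max => /and3P[xb b1 b2] M S.
  have [t1 [M1 [r1 S1 h1]]] := IH b1 M S.
  exists t1.+1, M1; split => //; last lia.
  by apply: run_if_true => //; rewrite (sim_reg S).
- move=> x c1 c2 m m' t w nz _ IH; rewrite !geq_max => /and3P[xb b1 b2] M S.
  have [t1 [M1 [r1 S1 h1]]] := IH b2 M S.
  exists t1.+1, M1; split => //; last lia.
  by apply: run_if_false => //; rewrite (sim_reg S).
- move=> x c m z; rewrite geq_max => /andP[xb b1] M S.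
  exists 1%N, M; split => //.
  by apply: run_while_done; rewrite (sim_reg S).
- move=> x c m1 m2 m3 t1 t2 w1 w2 nz _ IH1 _ IH2 bb M S.
  have /andP[xb b1] : (x < b)%N && (reg_bound c <= b)%N by rewrite -geq_max.
  have [t1' [M1 [r1 S1 h1]]] := IH1 b1 M S.
  have [t2' [M2 [r2 S2 h2]]] := IH2 bb M1 S1.
  exists (t1' + t2').+1, M2; split => //; last lia.
  by apply: run_while_step r1 r2; rewrite (sim_reg S).
Qed.

(** * Running the program once for each split of d *)

Definition clear (xs : seq nat) : cmd :=
  foldr (fun x c => Seq (Const (guest_reg x) 0) c) Skip xs.

Lemma clear_run xs M : exists M',
  [/\ run (clear xs) M (size xs).+1 [::] M',
      forall x, (x < 7)%N -> reg M' x = reg M x,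
      forall x, reg M' (guest_reg x)
        = if x \in xs then 0%N else reg M (guest_reg x)
    & Defs.mem M' = Defs.mem M].
Proof.
elim: xs M => [|x xs IH] M /=.
  by exists M; split => //; apply: run_skip.
have [M' [r lo hi me]] := IH (set_reg M (guest_reg x) 0).
exists M'; split => //.
- rewrite -add1n; apply: (@run_seq _ _ _ _ _ _ _ [::] [::] _ r).
  exact: run_const.
- by move=> y y7; rewrite lo //= /upd ifF //; rewrite /guest_reg; lia.
- move=> y; rewrite hi inE /= /upd /guest_reg !eqSS.
  by case: (y \in xs) => //; rewrite ?orbT ?orbF.
Qed.

(** One iteration: from the epoch i + 1 and the countdown d + 1 - i, the
    parameters i and d - i are obtained by subtracting one from each. The epoch
    starts at 1 because the stamps of the untouched memory are 0. *)
Definition round (P : cmd) : cmd :=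
  Seq (clear (iota 0 (3 + reg_bound P)))
  (Seq (Add (guest_reg 0) rN rZero)
  (Seq (Defs.Sub (guest_reg 1) rEpoch rOne)
  (Seq (Defs.Sub (guest_reg 2) rLeft rOne)
  (Seq (guest P)
  (Seq (Add rEpoch rEpoch rOne) (Defs.Sub rLeft rLeft rOne)))))).

Definition union_prog (P : cmd) : cmd :=
  Seq (Const rOne 1) (Seq (Const rEpoch 1)
  (Seq (Add rLeft rLeft rOne) (While rLeft (round P)))).

(** The stamps lie strictly below the epoch, so all of memory is erased for the
    coming run; the values under these stamps are arbitrary. *)
Definition ready (n l ep : nat) (M : state) : Prop :=
  host n l ep M /\ forall a, (stamp M a < ep)%N.

(** Advancing the epoch turns the invariant of the interpretation, that stamps
    are at most the current epoch, into the strict inequality that makes the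
    machine ready for the next run. *)
Lemma round_run P n l i M t w m : ready n l.+1 i.+1 M ->
  run P (init [:: n; i; l]) t w m ->
  exists t' M', [/\ run (round P) M t' w M', ready n l i.+2 M'
    & (t' <= 6 * t + reg_bound P + 9)%N].
Proof.
move=> [[H1 H2 H3 H4 H5] S] rP.
have [M1 [r1 lo hi me]] := clear_run (iota 0 (3 + reg_bound P)) M.
pose M4 := set_reg (set_reg (set_reg M1 (guest_reg 0) n) (guest_reg 1) i)
  (guest_reg 2) l.
have S4 : simulates (3 + reg_bound P) n l.+1 i.+1 (init [:: n; i; l]) M4.
  split.
  - by split; rewrite /= /upd /= lo.
  (* Registers 0, 1 and 2 hold the input; hence the 3 added to the bound. *)
  - case=> [|[|[|x]]] xb //=; rewrite /upd /= hi mem_iota xb /=.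
    by rewrite nth_nil.
  - move=> a; rewrite /stamp /= me ifF //.
    by have := S a; rewrite /stamp; case: eqP => // ->; rewrite ltnn.
  - by move=> a; rewrite /stamp /= me ltnW // S.
have [t5 [M5 [r5 S5 h5]]] := guest_run rP (leq_addl 3 _) S4.
have [K1 K2 K3 K4 K5] := sim_host S5.
pose M6 := set_reg (set_reg M5 rEpoch i.+2) rLeft l.
exists ((3 + reg_bound P).+1 + (1 + (1 + (1 + (t5 + (1 + 1))))))%N, M6.
split; last lia.
- rewrite size_iota in r1.
  apply: (@run_seq _ _ _ _ _ _ _ [::] w r1).
  apply: (@run_seq _ _ _ _ _ _ _ [::] w).
    have := run_add M1 (guest_reg 0) rN rZero.
    by rewrite !lo // H1 H5 addn0; apply.
  apply: (@run_seq _ _ _ _ _ _ _ [::] w).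
    have := run_sub (set_reg M1 (guest_reg 0) n) (guest_reg 1) rEpoch rOne.
    by rewrite /= /upd /= !lo // H3 H4 subn1; apply.
  apply: (@run_seq _ _ _ _ _ _ _ [::] w).
    have := run_sub (set_reg (set_reg M1 (guest_reg 0) n) (guest_reg 1) i)
      (guest_reg 2) rLeft rOne.
    by rewrite /= /upd /= !lo // H2 H4 subn1; apply.
  rewrite -[w]cats0; apply: run_seq r5 _.
  apply: (@run_seq _ _ _ _ _ _ _ [::] [::]).
    by have := run_add M5 rEpoch rEpoch rOne; rewrite K3 K4 addn1; apply.
  have := run_sub (set_reg M5 rEpoch i.+2) rLeft rLeft rOne.
  by rewrite /= /upd /= K2 K4 subn1; apply.
- split; first by split.
  by move=> a; rewrite /stamp /= ltnS; apply: sim_stamp S5 a.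
Qed.

Definition bits n (rows : seq (n.-tuple bool)) : seq nat :=
  flatten [seq map nat_of_bool (val a) | a <- rows].

(** Along the loop i + l is constant, equal to d + 1, so the second parameter
    i + l.-1 - j is d - j whatever the iteration. *)
Lemma loop_run P n (G : nat -> {set n.-tuple bool}) B l i M :
  ready n l i.+1 M ->
  (forall j, (i <= j < i + l)%N ->
    exists2 t, constructs P [:: n; j; i + l.-1 - j] (G j) t & (t <= B)%N) ->
  exists t' rows M', [/\ run (While rLeft (round P)) M t' (bits rows) M',
    rows =i (\bigcup_(i <= j < i + l) G j)%SET
    & (t' <= l * (6 * B + reg_bound P + 10) + 1)%N].
Proof.
elim: l i M => [|l IH] i M rdy con.
  exists 1%N, [::], M; split => //.
    by apply: run_while_done; case: rdy => -[].
  by move=> a; rewrite addn0 big_geq ?finset.in_set0.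
have [t [rows1 [m [e1 r1]]] tB] : exists2 t,
    constructs P [:: n; i; l] (G i) t & (t <= B)%N.
  have /con : (i <= i < i + l.+1)%N by lia.
  by rewrite addKn.
have [t1 [M1 [r1' rdy1 h1]]] := round_run rdy r1.
have [|t2 [rows2 [M2 [r2 e2 h2]]]] := IH i.+1 M1 rdy1.
  move=> j jr; have [|t' c' h'] := con j; first by lia.
  by exists t' => //; have -> : (i.+1 + l.-1 = i + l)%N by lia.
exists (t1 + t2).+1, (rows1 ++ rows2), M2; split; last by nia.
- rewrite /bits map_cat flatten_cat; apply: run_while_step r1' r2.
  by case: rdy => -[_ -> _ _ _].
- move=> a; rewrite mem_cat e1 e2 addSnnS [in RHS]big_ltn ?inE //.
  by rewrite addnS ltnS leq_addr.
Qed.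

(** The iteration for i prints the rows of G i; the concatenation lists the
    union, with repetitions when the families overlap. *)
Lemma union_prog_constructs P n d (G : nat -> {set n.-tuple bool}) B :
  (forall i, (i <= d)%N ->
    exists2 t, constructs P [:: n; i; d - i] (G i) t & (t <= B)%N) ->
  exists2 t, constructs (union_prog P) [:: n; d] (\bigcup_(i < d.+1) G i)%SET t
    & (t <= d.+1 * (6 * B + reg_bound P + 10) + 4)%N.
Proof.
move=> con.
pose M0 := set_reg (set_reg (init [:: n; d]) rOne 1) rEpoch 1.
pose M := set_reg M0 rLeft d.+1.
have [//||t [rows [M' [r e h]]]] := @loop_run P n G B d.+1 0 M.
  by move=> j jd; apply: con; lia.
exists (1 + (1 + (1 + t)))%N; last by lia.
exists rows, M'; split; first by move=> a; rewrite e big_mkord.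
rewrite -/(bits rows).
apply: (@run_seq _ _ _ _ _ _ _ [::]); first exact: run_const.
apply: (@run_seq _ _ _ _ _ _ _ [::]); first exact: run_const.
apply: (@run_seq _ _ _ _ _ _ _ [::] _ _ r).
have := run_add M0 rLeft rLeft rOne.
by rewrite /= /upd /= addn1; apply.
Qed.

Local Open Scope ring_scope.

(** * The union is universal *)

Lemma cff_union_universal (F : forall n r s : nat, {set n.-tuple bool}) n d :
  (forall i, (i <= d)%N -> cover_free i (d - i) (F n i (d - i)%N)) ->
  universal_set d (cff_union F n d).
Proof.
move=> cff i sigma mono.
have inj : injective i.
  move=> j k e; apply/val_inj/eqP; case: ltngtP => //= /mono; by rewrite e ltnn.
pose B := (i @: [set j | sigma j])%SET.
pose A := (i @: [set j | ~~ sigma j])%SET.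
have cB : #|B| = #|[set j | sigma j]%SET| by rewrite card_imset.
have Bd : (#|B| <= d)%N by rewrite cB -[d in (_ <= d)%N]card_ord max_card.
(* B and A are the images under i of complementary subsets of 'I_d. *)
have cA : #|A| = (d - #|B|)%N.
  have -> : #|A| = #|(~: [set j | sigma j])%SET|.
    by rewrite card_imset //; apply: eq_card => j; rewrite !inE.
  by rewrite cB cardsCs finset.setCK card_ord.
have dis : [disjoint B & A].
  rewrite disjoint_subset; apply/fintype.subsetP => _ /imsetP[j jB ->].
  rewrite inE.
  apply/imsetP => -[k kA /inj e]; move: jB kA; rewrite -e !inE => ->; done.
have [a aF [hB hA]] := cff _ Bd B A erefl cA dis.
exists a.
  by apply/bigcupP; exists (Ordinal (Bd : (#|B| < d.+1)%N)).
move=> j; case: (boolP (sigma j)) => sj.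
  by apply: hB; apply/imsetP; exists j; rewrite ?inE.
by apply/negbTE/hA; apply/imsetP; exists j; rewrite ?inE.
Qed.

(** * Binary entropy and logarithms to base 2 *)

Lemma ln2_gt0 {R : realType} : 0 < ln (2 : R).
Proof. by rewrite ln_gt0 // ltr1n. Qed.

Lemma log2_powR (R : realType) (x : R) : log2 (2 `^ x) = x.
Proof. by rewrite /log2 ln_powR mulfK // gt_eqF // ln2_gt0. Qed.

Lemma powR_log2 (R : realType) (x : R) : 0 < x -> 2 `^ (log2 x) = x.
Proof.
move=> x0; rewrite /powR gt_eqF // /log2 divfK ?gt_eqF ?ln2_gt0 //.
by rewrite lnK // posrE.
Qed.

Lemma ler_log2 (R : realType) (x y : R) : 0 < x -> x <= y -> log2 x <= log2 y.
Proof.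
move=> x0 xy; rewrite /log2 ler_pM2r ?invr_gt0 ?ln2_gt0 //.
by rewrite ler_ln // posrE // (lt_le_trans x0).
Qed.

Lemma log2_ge1 {R : realType} n : (1 < n)%N -> 1 <= log2 (n%:R : R).
Proof.
move=> n1; rewrite -[leLHS](log2_powR 1) powRr1 //.
by apply: ler_log2; rewrite ?ler_nat.
Qed.

Lemma log2_le_nat {R : realType} n : (0 < n)%N -> log2 (n%:R : R) <= n%:R.
Proof.
move=> n0; rewrite -[leRHS]log2_powR; apply: ler_log2; first by rewrite ltr0n.
by rewrite powR_mulrn // -natrX ler_nat ltnW // ltn_expl.
Qed.

(** This is p times the inequality ln y <= y - 1 at y = 1 / (2p), the tangent
    being taken where equality is wanted, at p = 1 / 2. Adding it for p and
    1 - p gives H2 <= 1. *)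
Lemma entropy_term_le (R : realType) (p : R) :
  0 <= p -> - (p * ln p) <= p * ln 2 + 2^-1 - p.
Proof.
rewrite le_eqVlt => /predU1P[<-|p0]; first by rewrite !mul0r; lra.
have := @le_ln1Dx R ((2 * p)^-1 - 1).
have i0 : 0 < (2 * p)^-1 by rewrite invr_gt0; lra.
rewrite [1 + _]addrC subrK lnV ?posrE ?mulr_gt0 // lnM ?posrE //.
move=> /(_ _)/wrap[].
  by lra.
rewrite -(ler_pM2l p0) => h.
have e : p * ((2 * p)^-1 - 1) = 2^-1 - p.
  by field; rewrite gt_eqF.
by rewrite e in h; lra.
Qed.

Lemma H2_ln (R : realType) (p : R) :
  H2 p * ln 2 = - (p * ln p) - (1 - p) * ln (1 - p).
Proof. by rewrite /H2 /log2; field; rewrite gt_eqF // ln2_gt0. Qed.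

Lemma H2_le1 (R : realType) (p : R) : 0 <= p <= 1 -> H2 p <= 1.
Proof.
move=> /andP[p0 p1]; rewrite -(ler_pM2r ln2_gt0) mul1r H2_ln.
have h1 := entropy_term_le p0.
have q0 : 0 <= 1 - p by lra.
by have h2 := entropy_term_le q0; lra.
Qed.

(** Both logarithms are expanded around 1 / 2: ln p <= - ln 2 suffices for the
    smaller probability, while the loss for the larger one is
    ln (2 (1 - p)) <= 1 - 2p. *)
Lemma H2_ge (R : realType) (p : R) :
  0 <= p <= 2^-1 -> 1 - (1 - 2 * p) / ln 2 <= H2 p.
Proof.
move=> /andP[p0 p1]; rewrite -(ler_pM2r ln2_gt0) H2_ln.
rewrite mulrBl mul1r divfK ?gt_eqF ?ln2_gt0 //.
have h1 : p * ln 2 <= - (p * ln p).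
  move: p0; rewrite le_eqVlt => /predU1P[<-|p0]; first by rewrite !mul0r oppr0.
  rewrite -mulrN ler_pM2l // -lnV ?posrE // ler_ln ?posrE ?invr_gt0 //.
  by rewrite -[leLHS]invrK lef_pV2 ?posrE ?invr_gt0.
have h2 : ln 2 + ln (1 - p) <= 1 - 2 * p.
  rewrite -lnM ?posrE //; last by lra.
  have -> : 2 * (1 - p) = 1 + (1 - 2 * p) by lra.
  by apply: le_ln1Dx; lra.
have h3 : (1 - p) * (ln 2 + ln (1 - p)) <= (1 - p) * (1 - 2 * p).
  by apply: ler_wpM2l => //; lra.
by nra.
Qed.

(** Rounding d / 2 down costs 1 - 2p <= 1 / d in the previous bound, hence only
    an additive constant after multiplication by d. *)
Lemma H2_half_ge {R : realType} d : (0 < d)%N ->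
  d%:R - (ln 2)^-1 <= H2 ((d./2)%:R / d%:R) * d%:R :> R.
Proof.
move=> d0; have d0' : 0 < d%:R :> R by rewrite ltr0n.
have hd : d%:R <= 2 * (d./2)%:R + 1 :> R.
  by rewrite -natrM natr1 ler_nat; lia.
have hd' : 2 * (d./2)%:R <= d%:R :> R by rewrite -natrM ler_nat; lia.
have := @H2_ge R ((d./2)%:R / d%:R).
rewrite divr_ge0 //= ler_pdivrMr // => /(_ _)/wrap[]; first lra.
rewrite -(ler_pM2r d0'); apply: le_trans.
set h := (d./2)%:R in hd hd' *.
have -> : (1 - (1 - 2 * (h / d%:R)) / ln 2) * d%:R =
   d%:R - (d%:R - 2 * h) * (ln 2)^-1 :> R.
  by field; rewrite !gt_eqF // ln2_gt0.
rewrite lerD2l lerN2 ler_piMl ?invr_ge0 ?(ltW ln2_gt0) //; lra.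
Qed.

(** The square root of 1 / d dominates both log2 d / d and 1 / d, and it
    serves as the common error term. *)
Lemma sqrt_inv_vanishing (R : realType) :
  vanishing (fun d => Num.sqrt (d%:R^-1 : R)).
Proof.
rewrite /vanishing -[X in (_ --> X)%classic](@sqrtr0 R).
rewrite -cvg_shiftS.
exact: (cvg_comp _ _ cvg_harmonic (@sqrt_continuous R 0)).
Qed.

(** Apply ln y <= y to y = sqrt d and double. *)
Lemma log2_le_sqrt {R : realType} d : (0 < d)%N ->
  log2 d%:R <= 2 / ln 2 * Num.sqrt (d%:R^-1) * d%:R :> R.
Proof.
move=> d0; have d0' : 0 < d%:R :> R by rewrite ltr0n.
set s := Num.sqrt _.
have s0 : 0 < s by rewrite sqrtr_gt0 invr_gt0.
have ss : s ^+ 2 = d%:R^-1 by rewrite sqr_sqrtr // invr_ge0 ltW.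
have sd : s * d%:R = s^-1.
  by rewrite -[d%:R]invrK -ss expr2 invfM mulVKf ?gt_eqF.
rewrite -mulrA sd /log2 mulrAC ler_pM2r ?invr_gt0 ?ln2_gt0 //.
rewrite -[d%:R]invrK -ss -exprVn lnXn ?invr_gt0 // -[leLHS]mulr_natl.
by rewrite ler_pM2l // ltW // ln_sublinear ?invr_gt0.
Qed.

(** * The size of the union *)

Lemma leq_card_bigcup (I T : finType) (A : I -> {set T}) :
  (#|\bigcup_i A i| <= \sum_i #|A i|)%N.
Proof.
elim/big_rec2: _ => [|i m B _ h]; first by rewrite cards0.
by rewrite (leq_trans (leq_card_setU _ _)) // leq_add2l.
Qed.

(** The exponent x is defined by the equation, so only its size is at stake: the
    upper bound of the union gives x <= 1 + |e d| d, as d + 1 <= 2d, and the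
    middle family gives x >= - 1 / ln 2 - |e d| d - log2 d. The constant c
    collects these three terms. *)
Lemma cff_union_size (R : realType)
    (F : forall n r s : nat, {set n.-tuple bool}) :
  almost_optimal R F ->
  exists2 e : nat -> R, vanishing e &
    forall n d : nat, (0 < d < n)%N ->
      exists2 x : R, `|x| <= e d * d%:R &
        #|cff_union F n d|%:R = d%:R * 2 `^ (d%:R + x) * log2 n%:R.
Proof.
move=> [e e0 opt].
pose c : R := 1 + (ln 2)^-1 + 2 / ln 2.
exists (fun d => `|e d| + c * Num.sqrt (d%:R^-1)).
  rewrite /vanishing -[X in (_ --> X)%classic](addr0 0).
  apply: cvgD; first by rewrite -(@normr0 _ R); apply: cvg_norm.
  by rewrite -(mulr0 c); apply: cvgMr; apply: sqrt_inv_vanishing.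
move=> n d /andP[d0 dn].
have d0' : 0 < d%:R :> R by rewrite ltr0n.
have L0 : 0 < log2 (n%:R : R).
  by apply: lt_le_trans (log2_ge1 _) => //; lia.
have part i : (i <= d)%N -> exists2 y : R, `|y| <= `|e d| * d%:R &
    #|F n i (d - i)%N|%:R = 2 `^ (H2 (i%:R / d%:R) * d%:R + y) * log2 n%:R.
  move=> id; have sd : (i + (d - i))%N = d by lia.
  have [|_ [y hy sz]] := opt n i (d - i)%N; first by rewrite sd d0.
  rewrite sd in hy sz; exists y => //; apply: le_trans hy _.
  by rewrite ler_pM2r // ler_norm.
(* A common factor of all sizes, abstracted so that cancellation does not reach
   into the quotient of logarithms that defines it. *)
move: L0 part; move: (log2 (n%:R : R)) => L L0 part.
set N : R := #|cff_union F n d|%:R.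
set E := `|e d| in part *.
have up : N / (d%:R * L) <= 2 `^ (1 + d%:R + E * d%:R).
  rewrite ler_pdivrMr ?mulr_gt0 //.
  apply: (@le_trans _ _ (\sum_(i < d.+1) #|F n i (d - i)%N|%:R)).
    by rewrite -natr_sum ler_nat; apply: leq_card_bigcup.
  apply: (@le_trans _ _ (\sum_(i < d.+1) 2 `^ (d%:R + E * d%:R) * L)).
    apply: ler_sum => i _; have id : (i <= d)%N by rewrite -ltnS.
    have [y hy ->] := part i id; rewrite ler_pM2r // ler_powR ?ler1n //.
    rewrite lerD //; last by apply: le_trans hy; apply: ler_norm.
    rewrite ler_piMl ?(ltW d0') // H2_le1 // divr_ge0 //=.
    by rewrite ler_pdivrMr // mul1r ler_nat.
  rewrite sumr_const card_ord -[leLHS]mulr_natl -[in leRHS]addrA.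
  rewrite (@powRD _ _ 1) ?pnatr_eq0 ?implybT // powRr1 //.
  set q := 2 `^ _; have q0 : 0 < q by rewrite powR_gt0.
  rewrite !mulrA ler_pM2r // [leLHS]mulrC.
  have -> : 2 * q * d%:R = q * (2 * d%:R) by ring.
  by rewrite ler_pM2l // -natrM ler_nat; lia.
have low : 2 `^ (d%:R - (ln 2)^-1 - E * d%:R - log2 d%:R)
    <= N / (d%:R * L).
  rewrite ler_pdivlMr ?mulr_gt0 //.
  have hd : (d./2 <= d)%N by lia.
  have [y hy sz] := part _ hd.
  apply: (@le_trans _ _ #|F n d./2 (d - d./2)%N|%:R); last first.
    rewrite ler_nat; apply/subset_leq_card.
    exact: (finset.bigcup_sup (Ordinal (hd : (d./2 < d.+1)%N))).
  rewrite powRB ?pnatr_eq0 ?implybT // powR_log2 // mulrA divfK ?gt_eqF //.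
  rewrite sz ler_pM2r // ler_powR ?ler1n // lerD ?H2_half_ge //.
  by have := lerNnormlW hy.
have N0 : 0 < N / (d%:R * L) by apply: lt_le_trans low; rewrite powR_gt0.
exists (log2 (N / (d%:R * L)) - d%:R); last first.
  rewrite addrC subrK powR_log2 //; field.
  by rewrite !gt_eqF.
have upl := ler_log2 N0 up; rewrite log2_powR in upl.
have lowl := ler_log2 (powR_gt0 _ (ltr0n R 2)) low.
rewrite log2_powR in lowl.
have hl := @log2_le_sqrt R d d0.
have s1 : 1 <= Num.sqrt (d%:R^-1) * d%:R :> R.
  set s := Num.sqrt _.
  have s0 : 0 < s by rewrite sqrtr_gt0 invr_gt0.
  have s1 : s <= 1 by rewrite -[leRHS]sqrtr1 ler_wsqrtr // invf_le1 // ler1n.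
  have e1 : s * (s * d%:R) = 1.
    by rewrite mulrA -expr2 sqr_sqrtr ?invr_ge0 ?(ltW d0') // mulVf ?gt_eqF.
  by rewrite -[leLHS]e1 ler_piMl // mulr_ge0 // ltW.
have i2 : 0 < (ln (2 : R))^-1 by rewrite invr_gt0 ln2_gt0.
rewrite mulrDl -/E; set s := Num.sqrt _ * _ in s1.
have e1 : c * Num.sqrt (d%:R^-1) * d%:R = s + (ln 2)^-1 * s + 2 / ln 2 * s.
  by rewrite /c /s; ring.
rewrite -mulrA -/s in hl; rewrite e1.
have i3 : (ln (2 : R))^-1 <= (ln 2)^-1 * s by rewrite ler_peMr // ltW.
have i4 : 0 <= 2 / ln 2 * s by rewrite !mulr_ge0 //; lra.
by rewrite ler_norml; apply/andP; split; lra.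
Qed.

(** * The time of each run is polynomial in 2^d and n *)

Lemma bin_le_exp2 d r : ('C(d, r) <= 2 ^ d)%N.
Proof.
elim: d r => [|d IH] [|r] //; first by rewrite bin0 expn_gt0.
by rewrite binS expnS mul2n -addnn leq_add.
Qed.

(** The lower bound lets powers of the expression be compared by their
    exponents; it holds as log2 y <= y. Both bounds use that the binomial
    coefficient is at least 2, so that its logarithm is at least 1. *)
Lemma cff_bound_range {R : realType} r s : (0 < r)%N -> (0 < s)%N ->
  1 <= cff_bound R r s <= (2 ^ (r + s))%:R ^+ 2.
Proof.
move=> r0 s0; set d := (r + s)%N.
have bin2 : (1 < 'C(d, r))%N.
  case: r s r0 s0 @d => [//|r] [//|s] _ _ /=.
  rewrite addSn binS -addn1 leq_add // bin_gt0; lia.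
have hb := bin_le_exp2 d r.
have lg1 := @log2_ge1 R _ bin2.
have lg2 : log2 ('C(d, r)%:R : R) <= 'C(d, r)%:R by apply: log2_le_nat; lia.
have lg0 : 0 < log2 ('C(d, r)%:R : R) by lra.
rewrite /cff_bound -/d; apply/andP; split.
  rewrite ler_pdivlMr // mul1r; apply: le_trans lg2 _.
  by rewrite ler_nat leq_pmull //; lia.
rewrite ler_pdivrMr //; apply: (@le_trans _ _ ((2 ^ d)%:R ^+ 2)); last first.
  by rewrite ler_peMr // exprn_ge0.
by rewrite -natrX ler_nat expnS expn1 leq_mul // ltnW // ltn_expl.
Qed.

(** A convergent error function is bounded by some natural number E. The scale
    is then at most 2^d to the power 2 (E + 1), and the factor n log n is at
    most n^2, which adds 2 to the degree. *)
Lemma linear_time_poly (R : realType)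
    (F : forall n r s : nat, {set n.-tuple bool}) :
  linear_time R F ->
  exists (P : cmd) (C k : nat), forall n r s : nat, (0 < r + s < n)%N ->
    exists2 t, constructs P [:: n; r; s] (F n r s) t
      & (t <= C * (2 ^ (r + s) + n) ^ k)%N.
Proof.
move=> [P [C [e [e0 lin]]]].
have [M [_ eM]] : bounded_fun e by apply/cvg_seq_bounded/cvgP/e0.
have [E eE] : exists E : nat, forall d, e d <= E%:R.
  exists (Num.trunc (`|M| + 1)).+1 => d; apply: le_trans (ler_norm _) _.
  apply: (@le_trans _ _ (`|M| + 1)); last by rewrite ltW // truncnS_gt.
  by apply: (eM (`|M| + 1)) => //; have := ler_norm M; lra.
pose C0 := (Num.trunc `|C|).+1.
have CC : C <= C0%:R.
  by apply: le_trans (ler_norm _) _; rewrite ltW // truncnS_gt.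
exists P, C0, (2 * E.+1 + 2)%N => n r s drs.
have [t con ht] := lin n r s drs; exists t => //.
set d := (r + s)%N in drs ht *.
pose D : R := (2 ^ d)%:R.
have D1 : 1 <= D by rewrite ler1n expn_gt0.
move: ht; set scale := (if _ then _ else _) => ht.
have scale0 : 0 <= scale by rewrite /scale; case: ifP => _; exact: powR_ge0.
have sc : scale <= D ^+ (2 * E.+1).
  rewrite /scale; case: ifP => [/andP[r0 s0]|_].
    have /andP[b1 b2] := @cff_bound_range R _ _ r0 s0.
    apply: (@le_trans _ _ (cff_bound R r s `^ E.+1%:R)).
      by apply: ler_powR => //; rewrite -natr1 addrC lerD2r.
    rewrite powR_mulrn; last lra.
    by rewrite exprM lerXn2r ?nnegrE ?exprn_ge0 //; lra.
  apply: (@le_trans _ _ (2 `^ (d * E)%:R)).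
    by rewrite ler_powR ?ler1n // natrM mulrC ler_wpM2l.
  rewrite powR_mulrn // exprM -natrX -/D; apply: ler_weXn2l => //; lia.
have L0 : 0 <= log2 (n%:R : R) <= n%:R.
  have n1 : (1 < n)%N by lia.
  by rewrite log2_le_nat ?andbT; [apply: le_trans (log2_ge1 n1) | lia].
have /andP[L1 L2] := L0.
rewrite -(ler_nat R); apply: le_trans ht _.
apply: (@le_trans _ _ (C0%:R * (scale * log2 n%:R * n%:R))).
  by rewrite ler_wpM2r // (mulr_ge0 (mulr_ge0 scale0 L1) (ler0n _ _)).
apply: (@le_trans _ _ (C0%:R * (D ^+ (2 * E.+1) * n%:R * n%:R))).
  by rewrite ler_wpM2l // ler_wpM2r // ler_pM.
rewrite -!natrX -!natrM ler_nat leq_mul2l -mulnA expnD; apply/orP; right.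
apply: leq_mul; first by rewrite leq_exp2r // leq_addr.
by rewrite mulnn leq_exp2r // leq_addl.
Qed.

Unset Implicit Arguments.

Theorem theorem2 (R : realType) (F : forall n r s : nat, {set n.-tuple bool})
    (F_cff : forall n r s : nat, (0 < r + s < n)%N -> cover_free r s (F n r s))
    (F_opt : almost_optimal R F)
    (F_time : linear_time R F) :
  (forall n d : nat, (0 < d < n)%N -> universal_set d (cff_union F n d)) /\
  poly_time (cff_union F) /\
  (exists2 e : nat -> R, vanishing e &
    forall n d : nat, (0 < d < n)%N ->
      exists2 x : R, `|x| <= e d * d%:R &
        #|cff_union F n d|%:R = d%:R * 2 `^ (d%:R + x) * log2 n%:R).
Proof.
split; [|split].
- move=> n d dn; apply: cff_union_universal => i id.
  by have := F_cff n i (d - i)%N; rewrite subnKC //; apply.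
- have [P [C [k time]]] := linear_time_poly F_time.
  exists (union_prog P), (6 * C + reg_bound P + 14)%N, k.+1 => n d dn.
  pose X := (2 ^ d + n)%N; pose B := (C * X ^ k)%N.
  have con i : (i <= d)%N ->
      exists2 t, constructs P [:: n; i; (d - i)%N] (F n i (d - i)%N) t
        & (t <= B)%N.
    by move=> id; have := time n i (d - i)%N; rewrite subnKC //; apply.
  have [t ct ht] := union_prog_constructs con; exists t => //.
  apply: leq_trans ht _; rewrite -/X expnS.
  have dX : (d.+1 <= X)%N.
    by rewrite /X -addn1 leq_add ?(ltnW (ltn_expl _ _)) //; lia.
  have X1 : (0 < X ^ k)%N by rewrite expn_gt0; lia.
  (* The 4 steps outside the loop are at most 4 X. *)
  apply: (@leq_trans (X * (6 * B + reg_bound P + 14))).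
    by rewrite /B; nia.
  by rewrite /B; nia.
- exact: cff_union_size.
Qed.
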